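(* The two following linear maps are surjective Hopf algebra morphisms from $(\mathcal{H}_{\mathbf{QP}},m,\Delta)$ to $\mathbf{WQSym}$: $$EHR:P\mapsto\sum_{w\in W_P}w,\qquad EHR^{str}:P\mapsto\sum_{w\in W^{str}_P}w\qquad(P\in\mathbf{QP}).$$
   Context: $\mathbb{K}$ is a field of characteristic zero, $[n]=\{1,\ldots,n\}$. $\mathbf{QP}(n)$ is the set of quasi-posets $P=([n],\leq_P)$ ($\leq_P$ reflexive and transitive), $\mathbf{QP}=\bigsqcup_{n\geq0}\mathbf{QP}(n)$; $i\sim_Pj$ means $i\leq_Pj$ and $j\leq_Pi$. $top(P)$ is the set of subsets $O\subseteq[n]$ with ($i\in O$, $i\leq_Pj$)$\Rightarrow j\in O$. For a quasi-poset on a subset of $\mathbb{N}$ with $n$ elements, $Std$ denotes its transport to $[n]$ by the increasing bijection. $\mathcal{H}_{\mathbf{QP}}$ is the $\mathbb{K}$-vector space with basis $\mathbf{QP}$; it is a Hopf algebra with product $m$: for $P\in\mathbf{QP}(k)$, $Q\in\mathbf{QP}(l)$, $PQ\in\mathbf{QP}(k+l)$ is the disjoint union of $P$ on $[k]$ and $Q$ shifted by $k$ on $\{k+1,\ldots,k+l\}$; and coproduct $\Delta(P)=\sum_{O\in top(P)}Std(P_{\mid[n]\setminus O})\otimes Std(P_{\mid O})$ for $P\in \mathbf{QP}(n)$. A packed word of length $n$ is a word $w=w_1\ldots w_n$ in positive integers with $\{w_1,\ldots,w_n\}=[k]$ for some $k\geq 0$; it is identified with the map $i\mapsto w(i)=w_i$.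 For any word $w$ in positive integers, $Pack(w)$ is the packed word obtained by applying to the letters the unique increasing bijection from the set of letters of $w$ onto some $[k]$. For $I\subseteq\mathbb{N}$, $w_I$ is the subword of $w$ formed by the letters in $I$. $\mathbf{WQSym}$ is the Hopf algebra with basis the packed words, with product $u.v=\sum w$, for $u,v$ packed of lengths $k,l$, over packed words $w=x_1\ldots x_{k+l}$ such that $Pack(x_1\ldots x_k)=u$ and $Pack(x_{k+1}\ldots x_{k+l})=v$; unit the empty word; coproduct $\Delta(w)=\sum_{k=0}^{\max(w)}w_{\{1,\ldots,k\}}\otimes Pack(w_{\{k+1,\ldots,\max(w)\}})$. For $P\in\mathbf{QP}(n)$, $W_P$ is the set of packed words $w$ of length $n$ such that $i\leq_Pj\Rightarrow w(i)\leq w(j)$; $W^{str}_P$ is the set of $w\in W_P$ such that ($i\leq_Pj$ and $w(i)=w(j)$) implies $i\sim_Pj$ (for the empty quasi-poset both consist of the empty word). *)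

(* Defs.v *)
From HB Require Import structures.
From mathcomp Require Import all_boot all_order all_algebra.
From mathcomp Require Import finmap.
From mathcomp Require Export monalg.

Set Implicit Arguments.
Unset Strict Implicit.
Unset Printing Implicit Defensive.

Import GRing.Theory.
Local Open Scope ring_scope.

(** * Linear algebra on free modules

    The vector space with basis [B] is [{malg K[B]}], and the tensor product of
    the spaces with bases [B] and [C] is the space with basis [B * C], the pair
    [(b, c)] standing for [b (x) c]. *)

Section FreeModules.
Variable K : fieldType.
Implicit Types B C : choiceType.

Definition lin_ext B (V : lmodType K) (f : B -> V) (x : {malg K[B]}) : V :=
  \sum_(b <- msupp x) x@_b *: f b.

Definition bilin_ext B C (V : lmodType K) (f : B -> C -> V)
    (x : {malg K[B]}) (y : {malg K[C]}) : V :=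
  lin_ext (fun b => lin_ext (f b) y) x.

Definition tensor B C : {malg K[B]} -> {malg K[C]} -> {malg K[(B * C)%type]} :=
  bilin_ext (fun b c => << (b, c) >>).

Definition tensor_map B C B' C' (f : {malg K[B]} -> {malg K[B']})
    (g : {malg K[C]} -> {malg K[C']}) :
    {malg K[(B * C)%type]} -> {malg K[(B' * C')%type]} :=
  lin_ext (fun p => tensor (f << p.1 >>) (g << p.2 >>)).

Lemma lin_extEw B (V : lmodType K) (f : B -> V) (x : {malg K[B]})
    (D : {fset B}) :
  (msupp x `<=` D)%fset -> lin_ext f x = \sum_(b <- D) x@_b *: f b.
Proof.
move=> sxD; rewrite /lin_ext; apply: big_fset_incl => // b _ bx.
by rewrite mcoeff_outdom ?scale0r.
Qed.

Lemma lin_ext_is_linear B (V : lmodType K) (f : B -> V) : linear (lin_ext f).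
Proof.
move=> a x y; set D := (msupp x `|` msupp y)%fset.
have sx : (msupp x `<=` D)%fset by apply: fsubsetUl.
have sy : (msupp y `<=` D)%fset by apply: fsubsetUr.
have sxy : (msupp (a *: x + y) `<=` D)%fset.
  by apply: fsubset_trans (msuppD_le _ _) _; rewrite fsetSU ?msuppZ_le.
rewrite !(lin_extEw _ sxy, lin_extEw _ sx, lin_extEw _ sy) scaler_sumr.
rewrite -big_split /=; apply: eq_bigr => b _.
by rewrite mcoeffD mcoeffZ scalerDl scalerA.
Qed.

Lemma lin_extU B (V : lmodType K) (f : B -> V) (b : B) :
  lin_ext f << b >> = f b.
Proof.
by rewrite /lin_ext msuppU oner_eq0 big_seq_fset1 mcoeffUU scale1r.
Qed.

Lemma bilin_extU B C (V : lmodType K) (f : B -> C -> V) b c :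
  bilin_ext f << b >> << c >> = f b c.
Proof. by rewrite /bilin_ext !lin_extU. Qed.

End FreeModules.

(** * Morphisms of Hopf algebras

    [hopf_ops K B] is the data of a product, unit, coproduct and counit on the
    vector space with basis [B]. *)

Record hopf_ops (K : fieldType) (B : choiceType) := HopfOps {
  hmul : {malg K[B]} -> {malg K[B]} -> {malg K[B]};
  hone : {malg K[B]};
  hcomul : {malg K[B]} -> {malg K[(B * B)%type]};
  hcounit : {malg K[B]} -> K
}.

Section HopfMorphisms.
Variable K : fieldType.

(** [S] is an antipode: m o (S (x) id) o Delta = eta o eps
    = m o (id (x) S) o Delta. *)
Definition is_antipode (B : choiceType) (H : hopf_ops K B)
    (S : {malg K[B]} -> {malg K[B]}) : Prop :=
  [/\ linear S,
      forall x, lin_ext (fun p : B * B => hmul H (S << p.1 >>) << p.2 >>)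
                  (hcomul H x) = hcounit H x *: hone H
    & forall x, lin_ext (fun p : B * B => hmul H << p.1 >> (S << p.2 >>))
                  (hcomul H x) = hcounit H x *: hone H].

Record hopf_morphism (B C : choiceType) (H : hopf_ops K B) (L : hopf_ops K C)
    (f : {malg K[B]} -> {malg K[C]}) : Prop := HopfMorphism {
  hopf_linear : linear f;
  hopf_mul : forall x y, f (hmul H x y) = hmul L (f x) (f y);
  hopf_one : f (hone H) = hone L;
  hopf_comul : forall x, hcomul L (f x) = tensor_map f f (hcomul H x);
  hopf_counit : forall x, hcounit L (f x) = hcounit H x;
  hopf_antipode : forall S T, is_antipode H S -> is_antipode L T ->
    forall x, f (S x) = T (f x)
}.

End HopfMorphisms.

(** * Quasi-posets

    The set [n] = {1, ..., n} is represented by ['I_n] = {0, ..., n - 1}. *)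

Definition is_qposet n (R : {set 'I_n * 'I_n}) : bool :=
  [forall i, (i, i) \in R] &&
  [forall i, forall j, forall k,
     ((i, j) \in R) && ((j, k) \in R) ==> ((i, k) \in R)].

Record qposet n := QPoset {
  qgraph : {set 'I_n * 'I_n};
  qgraphP : is_qposet qgraph
}.

HB.instance Definition _ n := [isSub for @qgraph n].
HB.instance Definition _ n := [Finite of qposet n by <:].

Definition qle n (P : qposet n) (i j : 'I_n) : bool := (i, j) \in qgraph P.

Definition qequiv n (P : qposet n) (i j : 'I_n) : bool := qle P i j && qle P j i.

Lemma qle_refl n (P : qposet n) : reflexive (qle P).
Proof. by move=> i; case/andP: (qgraphP P) => /forallP/(_ i). Qed.

Lemma qle_trans n (P : qposet n) : transitive (qle P).
Proof.
move=> j i k ij jk; case/andP: (qgraphP P) => _.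
move=> /forallP/(_ i)/forallP/(_ j)/forallP/(_ k)/implyP; apply.
exact/andP.
Qed.

Section QPosetOfRel.
Variables (n : nat) (r : rel 'I_n) (rr : reflexive r) (rt : transitive r).

Fact qposet_of_subproof : is_qposet [set p | r p.1 p.2].
Proof.
apply/andP; split; first by apply/forallP => i; rewrite inE /= rr.
apply/forallP => i; apply/forallP => j; apply/forallP => k; apply/implyP.
by rewrite !inE /= => /andP[]; apply: rt.
Qed.

Definition qposet_of : qposet n := QPoset qposet_of_subproof.

Lemma qle_of : qle qposet_of =2 r.
Proof. by move=> i j; rewrite /qle inE. Qed.

End QPosetOfRel.

Definition QP : choiceType := {n : nat & qposet n}.

Definition topens n (P : qposet n) : {set {set 'I_n}} :=
  [set O : {set 'I_n} |
    [forall i, forall j, (i \in O) && qle P i j ==> (j \in O)]].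

(** Std(P_{|A}).  [enum_val : 'I_#|A| -> 'I_n] lists the elements of [A] in
    increasing order, so that it is the inverse of the increasing bijection. *)
Section Std.
Variables (n : nat) (P : qposet n) (A : {set 'I_n}).

Definition std_rel (i j : 'I_#|A|) : bool := qle P (enum_val i) (enum_val j).

Fact std_refl : reflexive std_rel.
Proof. by move=> i; apply: qle_refl. Qed.

Fact std_trans : transitive std_rel.
Proof. by move=> j i k; apply: qle_trans. Qed.

Definition std_restr : QP := Tagged qposet (qposet_of std_refl std_trans).

End Std.

Section DisjointUnion.
Variables (k l : nat) (P : qposet k) (Q : qposet l).

Definition dunion_rel (i j : 'I_(k + l)) : bool :=
  match split i, split j with
  | inl a, inl b => qle P a b
  | inr a, inr b => qle Q a b
  | _, _ => false
  end.

Fact dunion_refl : reflexive dunion_rel.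
Proof. by move=> i; rewrite /dunion_rel; case: split => a; apply: qle_refl. Qed.

Fact dunion_trans : transitive dunion_rel.
Proof.
move=> j i m; rewrite /dunion_rel.
by case: (split i) => a; case: (split j) => b; case: (split m) => c //;
  apply: qle_trans.
Qed.

Definition dunion : qposet (k + l) := qposet_of dunion_refl dunion_trans.

End DisjointUnion.

Fact empty_qposet_subproof : is_qposet (set0 : {set 'I_0 * 'I_0}).
Proof. by apply/andP; split; apply/forallP => -[]. Qed.

Definition empty_QP : QP := Tagged qposet (QPoset empty_qposet_subproof).

Definition HQP (K : fieldType) : hopf_ops K QP := {|
  hmul := bilin_ext (fun P Q : QP =>
    << (Tagged qposet (dunion (tagged P) (tagged Q)) : QP) >>);
  hone := << empty_QP >>;
  hcomul := lin_ext (fun P : QP => \sum_(O in topens (tagged P))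
    << (std_restr (tagged P) (~: O), std_restr (tagged P) O) >>);
  hcounit := fun x => x@_empty_QP
|}.

(** * Packed words *)

(** The set of letters of [w] is {1, ..., k}; then [k] must be the number of
    distinct letters of [w]. *)
Definition is_packed (w : seq nat) : bool :=
  perm_eq (undup w) (iota 1 (size (undup w))).

Lemma is_packedP (w : seq nat) :
  reflect (exists k, w =i iota 1 k) (is_packed w).
Proof.
apply: (iffP idP) => [pw | [k wk]].
  by exists (size (undup w)) => x; rewrite -(perm_mem pw) mem_undup.
have pk : perm_eq (undup w) (iota 1 k).
  by rewrite uniq_perm ?undup_uniq ?iota_uniq // => x; rewrite mem_undup.
by rewrite /is_packed (perm_size pk) size_iota.
Qed.

Record pword := PWord { pseq :> seq nat; pseqP : is_packed pseq }.

HB.instance Definition _ := [isSub for pseq].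
HB.instance Definition _ := [Countable of pword by <:].

Definition pack_seq (w : seq nat) : seq nat :=
  [seq (index x (sort leq (undup w))).+1 | x <- w].

Lemma pack_seq_packed (w : seq nat) : is_packed (pack_seq w).
Proof.
apply/is_packedP; exists (size (undup w)) => y; rewrite mem_iota add1n ltnS.
set s := sort leq (undup w).
have ws x : (x \in s) = (x \in w) by rewrite mem_sort mem_undup.
have us : uniq s by rewrite sort_uniq undup_uniq.
have -> : size (undup w) = size s by rewrite size_sort.
apply/mapP/andP => [[x xw ->] | [y0 ys]].
  by rewrite index_mem ws.
case: y y0 ys => // y _ ys; exists (nth 0%N s y).
  by rewrite -ws mem_nth.
by rewrite -/s index_uniq.
Qed.

Definition pack (w : seq nat) : pword := PWord (pack_seq_packed w).

Lemma below_packed (w : pword) (k : nat) :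
  is_packed [seq x <- w | (x <= k)%N].
Proof.
have /is_packedP[m wm] := pseqP w; apply/is_packedP; exists (minn k m) => x.
rewrite mem_filter wm !mem_iota !add1n !ltnS leq_min.
by case: (0 < x)%N; rewrite ?andbF.
Qed.

(** w_{1, ..., k} *)
Definition below (w : pword) (k : nat) : pword := PWord (below_packed w k).

(** Pack(w_{k+1, ..., max(w)}) *)
Definition above (w : pword) (k : nat) : pword := pack [seq x <- w | (k < x)%N].

Definition maxw (w : pword) : nat := \max_(x <- w) x.

(** The packed words of length [n]; their letters are at most [n]. *)
Definition packed_words (n : nat) : seq pword :=
  pmap insub [seq [seq val x | x <- val t] | t <- enum {: n.-tuple 'I_n.+1}].

Lemma packed_words_uniq (n : nat) : uniq (packed_words n).
Proof.
apply: (pmap_uniq (g := val)); first exact: insubK.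
rewrite map_inj_uniq ?enum_uniq // => t u /inj_map tu.
by apply: val_inj; apply: tu; apply: val_inj.
Qed.

Lemma mem_packed_words (n : nat) (w : pword) :
  (w \in packed_words n) = (size w == n).
Proof.
rewrite mem_pmap_sub /=; apply/mapP/eqP => [[t _ ->] | <-].
  by rewrite size_map size_tuple.
have /is_packedP[k wk] := pseqP w.
have kw : (k <= size w)%N.
  rewrite -(size_iota 1 k); apply: uniq_leq_size; first exact: iota_uniq.
  by move=> x; rewrite wk.
pose t := map_tuple (fun x => inord x : 'I_(size w).+1) (in_tuple (pseq w)).
exists t; first by rewrite mem_enum.
rewrite /= -map_comp -[LHS]map_id; apply/eq_in_map => x /=.
rewrite wk mem_iota add1n ltnS => /andP[_ xk].
by rewrite inordK // ltnS (leq_trans xk).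
Qed.

Definition WQSym (K : fieldType) : hopf_ops K pword := {|
  hmul := bilin_ext (fun u v : pword =>
    \sum_(w <- packed_words (size u + size v)
          | (pack (take (size u) w) == u) && (pack (drop (size u) w) == v))
      << w >>);
  hone := << pack [::] >>;
  hcomul := lin_ext (fun w : pword =>
    \sum_(0 <= k < (maxw w).+1) << (below w k, above w k) >>);
  hcounit := fun x => x@_(pack [::])
|}.

(** * The maps EHR and EHR^str *)

(** An element [i : 'I_n] stands for i + 1, whose image under [w] is [nth 0 w i]. *)

Definition in_W n (P : qposet n) (w : pword) : bool :=
  (size w == n) &&
  [forall i, forall j, qle P i j ==> (nth 0 w i <= nth 0 w j)%N].

Definition in_Wstr n (P : qposet n) (w : pword) : bool :=
  in_W P w &&
  [forall i, forall j,
     qle P i j && (nth 0 w i == nth 0 w j)%N ==> qequiv P i j].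

Definition EHR (K : fieldType) : {malg K[QP]} -> {malg K[pword]} :=
  lin_ext (fun P : QP =>
    \sum_(w <- packed_words (tag P) | in_W (tagged P) w) << w >>).

Definition EHRstr (K : fieldType) : {malg K[QP]} -> {malg K[pword]} :=
  lin_ext (fun P : QP =>
    \sum_(w <- packed_words (tag P) | in_Wstr (tagged P) w) << w >>).

(* Main.v *)
From HB Require Import structures.
Require Import Defs.
From mathcomp Require Import all_boot all_order all_algebra.
From mathcomp Require Import finmap zify.
Local Open Scope ring_scope.

(** Both maps send a quasi-poset [P] to the sum of the packed words that respect
    [P], weakly or strictly.  Whether a word respects [P] depends only on the
    order of its letters, and a packed word is determined by that order
    ([packed_same_order]).  The two cases differ by one clause, so a boolean [c]
    carries it and everything is proved for both at once.

    Product.  A word respects the disjoint union of [P] and [Q] iff its first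
    letters respect [P] and its last letters respect [Q]
    ([linearises_dunion]); grouping these words by the packings of their two
    parts gives the product of the two sums.

    Coproduct.  Cutting a word [w] that respects [P] at height [k] singles out
    the open set [O] of the positions whose letter exceeds [k]; the two halves
    respect the restrictions of [P] to the complement of [O] and to [O].
    Conversely two such words are glued by raising the second above the first.
    For fixed [O] this is a bijection ([perm_cut_restr]).

    Antipode.  If [f] is a bialgebra morphism and [S], [T] are antipodes, then
    both [f o S] and [T o f] are left inverses of [f] for convolution.  In the
    convolution product of [g] and [f] at [P], the term of the empty open set is
    [g P] and the other terms involve [g] only at smaller quasi-posets
    ([conv_rec]).  So a left inverse is determined recursively, and the two
    agree.

    Surjectivity.  A packed word [w] orders its positions totally; the image of
    this quasi-poset is [w] plus words whose order has strictly more relations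
    ([linearises_pattern_lt]), and induction on the number of missing relations
    reaches every packed word ([im_word]). *)

Set Implicit Arguments.
Unset Strict Implicit.
Unset Printing Implicit Defensive.

Import GRing.Theory.

(** * Order patterns of words *)

Section Patterns.
Local Open Scope nat_scope.

Definition same_order (s t : seq nat) : Prop :=
  size s = size t /\
  forall i j, i < size s -> j < size s ->
    (nth 0 s i <= nth 0 s j) = (nth 0 t i <= nth 0 t j).

Lemma same_order_sym s t : same_order s t -> same_order t s.
Proof.
by case=> st h; split=> // i j; rewrite -st => hi hj; rewrite h.
Qed.

Lemma same_order_trans t s r :
  same_order s t -> same_order t r -> same_order s r.
Proof.
move=> [st hst] [tr htr]; split; first by rewrite st.
by move=> i j hi hj; rewrite hst // htr // -st.
Qed.

Lemma mem_packed (w : pword) x : (x \in pseq w) = (0 < x <= maxw w).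
Proof.
have /is_packedP[k wk] := pseqP w.
suff -> : maxw w = k by rewrite wk mem_iota add1n ltnS.
apply/eqP; rewrite eqn_leq; apply/andP; split.
  by apply/bigmax_leqP_seq => y; rewrite wk mem_iota add1n ltnS => /andP[].
case: k wk => // k wk; apply: (leq_bigmax_seq k.+1) => //.
by rewrite wk mem_iota /= add1n ltnSn.
Qed.

(** Since no letter is skipped, a letter [m + 2] of [u] has a letter [m + 1]
    strictly below it; the corresponding letters of [v] are in the same strict
    order, so the bound climbs by one at each step. *)
Lemma packed_le_of_same_order (u v : pword) i :
  same_order u v -> i < size u -> nth 0 u i <= nth 0 v i.
Proof.
move=> [uv h]; move eqm: (nth 0 u i) => m.
elim/ltn_ind: m i eqm => -[//|[|m]] IHm i ui hi.
  have: nth 0 v i \in pseq v by rewrite mem_nth -?uv.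
  by rewrite mem_packed => /andP[].
have: m.+1 \in pseq u.
  have: nth 0 u i \in pseq u by rewrite mem_nth.
  by rewrite !mem_packed ui => /andP[_ /ltnW].
case/(nthP 0) => j hj uj.
have vj := IHm _ (ltnSn _) j uj hj.
have := h i j hi hj; rewrite ui uj ltnn => /esym/negbT; rewrite -ltnNge.
exact: leq_ltn_trans.
Qed.

Lemma packed_same_order (u v : pword) : same_order u v -> u = v.
Proof.
move=> uv; apply: val_inj; apply: (@eq_from_nth _ 0); first by case: uv.
move=> i hi; apply/eqP; rewrite eqn_leq packed_le_of_same_order //=.
by apply: packed_le_of_same_order; [exact: same_order_sym | case: uv => <-].
Qed.

Lemma same_order_pack s : same_order (pack s) s.
Proof.
split=> [|i j]; rewrite /= size_map // => hi hj.
rewrite !(nth_map 0) // ltnS; set r := sort leq (undup s).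
have sr : sorted leq r := sort_sorted leq_total _.
have inr k : k < size s -> nth 0 s k \in r.
  by move=> hk; rewrite mem_sort mem_undup mem_nth.
apply/idP/idP => [|sij].
  exact: (sorted_leq_index leq_trans leqnn sr _ _ (inr _ hi) (inr _ hj)).
rewrite leqNgt; apply/negP => lt.
have := sorted_leq_index leq_trans leqnn sr _ _ (inr _ hj) (inr _ hi) (ltnW lt).
by move=> sji; move: lt; rewrite (@anti_leq (nth 0 s j) (nth 0 s i)) ?sij ?sji ?ltnn.
Qed.

Lemma pack_eqP s (u : pword) : reflect (same_order s u) (pack s == u).
Proof.
apply: (iffP eqP) => [<- | su].
  exact/same_order_sym/same_order_pack.
by apply: packed_same_order; apply: same_order_trans su; apply: same_order_pack.
Qed.

Lemma pack_id (u : pword) : pack u = u.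
Proof. exact/eqP/pack_eqP. Qed.

Lemma size_pack s : size (pack s) = size s.
Proof. by rewrite /= size_map. Qed.

End Patterns.

(** * Subwords carried by a set of positions *)

Section Subwords.
Local Open Scope nat_scope.
Variable n : nat.
Implicit Types (w : seq nat) (A : {set 'I_n}).

Definition subword w A : seq nat := [seq nth 0 w (val i) | i <- enum A].

Lemma size_subword w A : size (subword w A) = #|A|.
Proof. by rewrite size_map cardE. Qed.

Lemma nth_subword w A (i : 'I_#|A|) : nth 0 (subword w A) i = nth 0 w (enum_val i).
Proof.
rewrite (nth_map (enum_val i)) -?cardE //.
by rewrite -enum_val_nth.
Qed.

Lemma filter_subword w (p : pred nat) : size w = n ->
  [seq x <- w | p x] = subword w [set i : 'I_n | p (nth 0 w i)].
Proof.
move=> sw; have {1}-> : w = [seq nth 0 w (val i) | i <- enum 'I_n].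
  by rewrite (map_comp (nth 0 w) val) val_enum_ord -sw; apply/esym/mkseq_nth.
rewrite filter_map /subword; congr map.
rewrite [RHS]/enum_mem -enumT; apply: eq_filter => i.
by rewrite [RHS]in_set.
Qed.

Lemma enum_val_onto A i : i \in A -> exists a : 'I_#|A|, i = enum_val a.
Proof. by move=> iA; exists (enum_rank_in iA i); rewrite enum_rankK_in. Qed.

End Subwords.

(** * Linear extensions of quasi-posets *)

Section Linearises.
Local Open Scope nat_scope.

(** The words of [W_P] for [c = false] and of [W_P^str] for [c = true].  When
    [i <= j] in [P] and the word is monotone, equality of the letters at [i] and
    [j] amounts to the reverse inequality, and [i ~ j] to [j <= i]; in this form
    only comparisons of letters occur. *)
Definition linearises (c : bool) n (P : qposet n) (s : seq nat) : bool :=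
  (size s == n) &&
  [forall i, forall j, qle P i j ==>
     (nth 0 s i <= nth 0 s j) &&
     (c && (nth 0 s j <= nth 0 s i) ==> qle P j i)].

Lemma linearisesP (c : bool) n (P : qposet n) s :
  reflect (size s = n /\ forall i j, qle P i j ->
             nth 0 s i <= nth 0 s j /\
             (c -> nth 0 s j <= nth 0 s i -> qle P j i))
          (linearises c P s).
Proof.
apply: (iffP andP) => -[sn h]; split; try exact/eqP.
  move=> i j ij; have /forallP/(_ i)/forallP/(_ j) := h.
  rewrite ij => /andP[-> /implyP hc]; split=> // cc sij.
  by apply: hc; rewrite cc sij.
apply/forallP => i; apply/forallP => j; apply/implyP => ij.
have [-> hc] := h i j ij; apply/implyP => /andP[cc].
exact: hc.
Qed.

Lemma in_WE n (P : qposet n) (w : pword) : in_W P w = linearises false P w.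
Proof.
by congr (_ && _); apply: eq_forallb => i; apply: eq_forallb => j; rewrite andbT.
Qed.

Lemma in_WstrE n (P : qposet n) (w : pword) : in_Wstr P w = linearises true P w.
Proof.
apply/andP/linearisesP => [[/andP[/eqP sw hw] hs] | [sw h]].
  split=> // i j ij.
  have lij : nth 0 w i <= nth 0 w j.
    by move: hw => /'forall_forallP/(_ i j); rewrite ij.
  split=> // _ lji; have /forallP/(_ i)/forallP/(_ j) := hs.
  by rewrite ij eqn_leq lij lji => /andP[].
split; last first.
  apply/'forall_forallP => i j; apply/implyP => /andP[ij /eqP e].
  by rewrite /qequiv ij /=; apply: (h i j ij).2; rewrite // e.
rewrite /in_W sw eqxx; apply/'forall_forallP => i j; apply/implyP => ij.
exact: (h i j ij).1.
Qed.

Lemma linearises_same_order c n (P : qposet n) s t :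
  same_order s t -> linearises c P s = linearises c P t.
Proof.
suff imp s' t' : same_order s' t' -> linearises c P s' -> linearises c P t'.
  by move=> st; apply/idP/idP; apply: imp => //; exact: same_order_sym.
move=> [st h] /linearisesP[sn hs]; apply/linearisesP; split; first by rewrite -st.
by move=> i j /hs; rewrite !h ?sn.
Qed.

Lemma linearises_dunion c k l (P : qposet k) (Q : qposet l) s :
  size s = k + l ->
  linearises c (dunion P Q) s =
    linearises c P (take k s) && linearises c Q (drop k s).
Proof.
move=> skl.
have sz : size (take k s) = k by rewrite size_takel // skl leq_addr.
have sz' : size (drop k s) = l by rewrite size_drop skl addKn.
have dl a b : qle (dunion P Q) (lshift l a) (lshift l b) = qle P a b.
  by rewrite qle_of /dunion_rel !(unsplitK (inl _)).
have dr a b : qle (dunion P Q) (rshift k a) (rshift k b) = qle Q a b.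
  by rewrite qle_of /dunion_rel !(unsplitK (inr _)).
have nt (a : 'I_k) : nth 0 (take k s) a = nth 0 s (lshift l a) by rewrite nth_take.
have nd (a : 'I_l) : nth 0 (drop k s) a = nth 0 s (rshift k a) by rewrite nth_drop.
apply/linearisesP/andP => [[_ h] | [/linearisesP[_ hP] /linearisesP[_ hQ]]].
  split; apply/linearisesP; split=> // a b ab.
    by rewrite !nt -dl; apply: h; rewrite dl.
  by rewrite !nd -dr; apply: h; rewrite dr.
split=> // i j.
case: (split_ordP i) => a ->; case: (split_ordP j) => b ->.
- by rewrite !dl -!nt; apply: hP.
- by rewrite qle_of /dunion_rel (unsplitK (inl _)) (unsplitK (inr _)).
- by rewrite qle_of /dunion_rel (unsplitK (inl _)) (unsplitK (inr _)).
by rewrite !dr -!nd; apply: hQ.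
Qed.

Lemma qle_std_restr n (P : qposet n) (A : {set 'I_n}) (i j : 'I_#|A|) :
  qle (tagged (std_restr P A)) i j = qle P (enum_val i) (enum_val j).
Proof. exact: qle_of. Qed.

Lemma linearises_restr c n (P : qposet n) (A : {set 'I_n}) s :
  linearises c P s -> linearises c (tagged (std_restr P A)) (subword s A).
Proof.
move=> /linearisesP[sn h]; apply/linearisesP; split; first exact: size_subword.
by move=> i j; rewrite !qle_std_restr !nth_subword; apply: h.
Qed.

Lemma topensP n (P : qposet n) (O : {set 'I_n}) :
  reflect (forall i j, i \in O -> qle P i j -> j \in O) (O \in topens P).
Proof.
rewrite inE; apply: (iffP 'forall_forallP) => h i j.
  by move=> iO ij; move: (h i j); rewrite iO ij.
by apply/implyP => /andP[]; apply: h.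
Qed.

End Linearises.

(** * Cutting and gluing words *)

Section CutGlue.
Local Open Scope nat_scope.
Variable n : nat.
Implicit Types (w u v : pword) (O : {set 'I_n}) (P : qposet n).

Definition cut w k : {set 'I_n} := [set i : 'I_n | k < nth 0 w i].

Lemma below_cut w k : size w = n -> pseq (below w k) = subword w (~: cut w k).
Proof.
move=> sw; rewrite /= (filter_subword (fun x => x <= k) sw); congr subword.
by apply/setP => i; rewrite !inE -leqNgt.
Qed.

Lemma above_cut w k : size w = n -> above w k = pack (subword w (cut w k)).
Proof. by move=> sw; rewrite /above (filter_subword (fun x => k < x) sw). Qed.

(** The cutting height is recovered from the lower half, because every letter
    up to [k] occurs in [w]. *)
Lemma maxw_below w k : k <= maxw w -> maxw (below w k) = k.
Proof.
have mem x : (0 < x <= maxw (below w k)) = (x <= k) && (0 < x <= maxw w).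
  by rewrite -!mem_packed /= mem_filter.
move=> kw; apply/eqP; rewrite eqn_leq; apply/andP; split.
  case: (posnP (maxw (below w k))) => [-> //|m0].
  by have := mem (maxw (below w k)); rewrite m0 leqnn => /esym/andP[].
case: (posnP k) => [-> //|k0].
by have := mem k; rewrite leqnn k0 kw => /andP[].
Qed.

Lemma cut_topens (c : bool) P w k : linearises c P w -> cut w k \in topens P.
Proof.
move=> /linearisesP[_ h]; apply/topensP => i j; rewrite !inE => ki ij.
exact: leq_trans ki (h i j ij).1.
Qed.

(** Two letters are on the same side of the cut, where one of the two halves
    compares them, or on opposite sides, where the cut itself does. *)
Lemma cut_inj w w' k k' : size w = n -> size w' = n ->
  k <= maxw w -> k' <= maxw w' -> cut w k = cut w' k' ->
  below w k = below w' k' -> above w k = above w' k' -> w = w' /\ k = k'.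
Proof.
move=> sw sw' kw kw' eO eb ea.
have ek : k = k' by rewrite -(maxw_below kw) eb maxw_below.
split=> //; subst k'; apply: packed_same_order.
split=> [|i0 j0]; first by rewrite sw.
rewrite sw => hi hj; pose i := Ordinal hi; pose j := Ordinal hj.
change ((nth 0 w i <= nth 0 w j) = (nth 0 w' i <= nth 0 w' j)).
have in_cut a : (k < nth 0 w a) = (k < nth 0 w' a) :> bool.
  case: (ltnP a n) => [an|na]; last by rewrite !nth_default ?sw ?sw'.
  by have /setP/(_ (Ordinal an)) := eO; rewrite !inE.
have [ki|ki] := ltnP k (nth 0 w i); have [kj|kj] := ltnP k (nth 0 w j).
- have iO : i \in cut w k by rewrite inE.
  have jO : j \in cut w k by rewrite inE.
  have [a ->] := enum_val_onto iO; have [b ->] := enum_val_onto jO.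
  move: ea; rewrite !above_cut // -eO => /eqP/pack_eqP sO.
  have [sz cmp] := same_order_trans sO (same_order_pack _).
  by rewrite -!nth_subword cmp ?size_subword.
- have := in_cut i; have := in_cut j; lia.
- have := in_cut i; have := in_cut j; lia.
have iO : i \in ~: cut w k by rewrite !inE -leqNgt.
have jO : j \in ~: cut w k by rewrite !inE -leqNgt.
have [a ->] := enum_val_onto iO; have [b ->] := enum_val_onto jO.
by rewrite -!nth_subword -below_cut // eb below_cut // -eO.
Qed.

(** [index i (enum A)] is the rank of [i] in [A], that is, the inverse of the
    increasing enumeration [enum_val] used for [std_restr]. *)
Definition glue O u v : seq nat :=
  [seq if i \in O then maxw u + nth 0 v (index i (enum O))
       else nth 0 u (index i (enum (~: O))) | i <- enum 'I_n].

Lemma size_glue O u v : size (glue O u v) = n.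
Proof. by rewrite size_map size_enum_ord. Qed.

Lemma index_enum_val (A : {set 'I_n}) (a : 'I_#|A|) :
  index (enum_val a) (enum A) = a.
Proof.
by rewrite (enum_val_nth (enum_val a)) index_uniq ?enum_uniq // -cardE.
Qed.

Lemma nth_glue O u v (i : 'I_n) : nth 0 (glue O u v) i =
  if i \in O then maxw u + nth 0 v (index i (enum O))
  else nth 0 u (index i (enum (~: O))).
Proof. by rewrite (nth_map i) ?size_enum_ord // nth_ord_enum. Qed.

Lemma nth_glue_in O u v (a : 'I_#|O|) :
  nth 0 (glue O u v) (enum_val a) = maxw u + nth 0 v a.
Proof. by rewrite nth_glue enum_valP index_enum_val. Qed.

Lemma nth_glue_out O u v (a : 'I_#|~: O|) :
  nth 0 (glue O u v) (enum_val a) = nth 0 u a.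
Proof.
rewrite nth_glue; have := enum_valP a; rewrite inE => /negbTE ->.
by rewrite index_enum_val.
Qed.

Lemma nth_packed u i : i < size u -> 0 < nth 0 u i <= maxw u.
Proof. by move=> hi; rewrite -mem_packed mem_nth. Qed.

Section Glue.
Variables (O : {set 'I_n}) (u v : pword).
Hypotheses (su : size u = #|~: O|) (sv : size v = #|O|).

Lemma glue_packed : is_packed (glue O u v).
Proof.
apply/is_packedP; exists (maxw u + maxw v) => x.
rewrite mem_iota add1n ltnS; apply/(nthP 0)/idP => [[i0]|].
  rewrite size_glue => hi <-; rewrite -[i0]/(val (Ordinal hi)).
  have [iO|iO] := boolP (Ordinal hi \in O).
    have [a ->] := enum_val_onto iO; rewrite nth_glue_in.
    have /andP[] : 0 < nth 0 v a <= maxw v by rewrite nth_packed ?sv.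
    by lia.
  have [|a ->] := @enum_val_onto _ (~: O) (Ordinal hi); first by rewrite inE.
  rewrite nth_glue_out; have /andP[] : 0 < nth 0 u a <= maxw u.
    by rewrite nth_packed ?su.
  by lia.
case/andP=> x0 xm; have [xu|ux] := leqP x (maxw u).
  have /(nthP 0)[i] : x \in pseq u by rewrite mem_packed x0.
  rewrite su => hi <-; exists (enum_val (Ordinal hi) : nat).
    by rewrite size_glue ltn_ord.
  by rewrite nth_glue_out.
have /(nthP 0)[i] : x - maxw u \in pseq v by rewrite mem_packed; lia.
rewrite sv => hi e; exists (enum_val (Ordinal hi) : nat).
  by rewrite size_glue ltn_ord.
by rewrite nth_glue_in /= e; lia.
Qed.

Definition glue_word : pword := PWord glue_packed.

Lemma cut_glue : cut glue_word (maxw u) = O.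
Proof.
apply/setP => i; rewrite inE /=.
have [iO|iO] := boolP (i \in O).
  have [a ->] := enum_val_onto iO; rewrite nth_glue_in.
  have /andP[] : 0 < nth 0 v a <= maxw v by rewrite nth_packed ?sv.
  by lia.
have [|a ->] := @enum_val_onto _ (~: O) i; first by rewrite inE.
rewrite nth_glue_out; have /andP[] : 0 < nth 0 u a <= maxw u.
  by rewrite nth_packed ?su.
by lia.
Qed.

Lemma maxw_glue : maxw u <= maxw glue_word.
Proof.
case: (posnP (maxw u)) => [-> //|u0].
have /(nthP 0)[i] : maxw u \in pseq u by rewrite mem_packed u0 leqnn.
rewrite su => hi e; have : maxw u \in pseq glue_word.
  rewrite -e -[i]/(val (Ordinal hi)) -(nth_glue_out u v).
  by rewrite mem_nth // size_glue ltn_ord.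
by rewrite mem_packed => /andP[].
Qed.

Lemma below_glue : below glue_word (maxw u) = u.
Proof.
apply: val_inj => /=.
rewrite -[LHS]/(pseq (below glue_word (maxw u))) below_cut ?size_glue // cut_glue.
apply: (@eq_from_nth _ 0); rewrite size_subword ?su // => i hi.
by rewrite -[i]/(val (Ordinal hi)) nth_subword nth_glue_out.
Qed.

Lemma above_glue : above glue_word (maxw u) = v.
Proof.
rewrite above_cut ?size_glue // cut_glue; apply/eqP/pack_eqP.
split=> [|i j]; rewrite size_subword ?sv // => hi hj.
rewrite -[i]/(val (Ordinal hi)) -[j]/(val (Ordinal hj)) !nth_subword !nth_glue_in.
by rewrite leq_add2l.
Qed.

(** A relation from the complement to the open set is respected strictly, every
    letter on the latter being larger; none goes the other way. *)
Lemma linearises_glue c P : O \in topens P ->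
  linearises c (tagged (std_restr P (~: O))) u ->
  linearises c (tagged (std_restr P O)) v -> linearises c P (glue O u v).
Proof.
move=> /topensP openO /linearisesP[_ hu] /linearisesP[_ hv].
apply/linearisesP; split=> [|i j ij]; first exact: size_glue.
have [iO|iO] := boolP (i \in O); have [jO|jO] := boolP (j \in O).
- move: ij; have [a ->] := enum_val_onto iO; have [b ->] := enum_val_onto jO.
  by rewrite !nth_glue_in !leq_add2l -!qle_std_restr; apply: hv.
- by rewrite (openO i j) in jO.
- have [|a ->] := @enum_val_onto _ (~: O) i; first by rewrite inE.
  have [b ->] := enum_val_onto jO; rewrite nth_glue_in nth_glue_out.
  have := @nth_packed u a; rewrite su ltn_ord => /(_ isT)/andP[_ ua].
  have := @nth_packed v b; rewrite sv ltn_ord => /(_ isT)/andP[vb _].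
  by split=> [|_ ]; lia.
move: ij; have [|a ->] := @enum_val_onto _ (~: O) i; first by rewrite inE.
have [|b ->] := @enum_val_onto _ (~: O) j; first by rewrite inE.
by rewrite !nth_glue_out -!qle_std_restr; apply: hu.
Qed.

End Glue.

(** For a fixed open set [O], cutting is a bijection from the pairs of a word
    respecting [P] and a height with upper part [O] onto the pairs of words that
    respect the two restrictions of [P]; gluing at height [maxw u] inverts it. *)
Lemma perm_cut_restr c P O : O \in topens P ->
  perm_eq
    [seq (below p.1 p.2, above p.1 p.2) |
       p : pword * nat <- [seq (w, k) | w <- packed_words n,
                                        k <- index_iota 0 (maxw w).+1]
       & linearises c P p.1 && (cut p.1 p.2 == O)]
    [seq (u, v) |
       u <- [seq u <- packed_words #|~: O|
              | linearises c (tagged (std_restr P (~: O))) (pseq u)],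
       v <- [seq v <- packed_words #|O|
              | linearises c (tagged (std_restr P O)) (pseq v)]].
Proof.
move=> openO.
set S := [seq p <- _ | _].
have memS w k : ((w, k) \in S) =
    [&& linearises c P w, cut w k == O, size w == n & k <= maxw w].
  rewrite mem_filter [X in X && _]/= -andbA; do 2!congr (_ && _).
  apply/allpairsPdep/andP => [[w' [k' [hw hk [-> ->]]]] | [hw hk]].
    by rewrite -mem_packed_words hw; move: hk; rewrite mem_index_iota ltnS.
  by exists w, k; rewrite mem_packed_words mem_index_iota.
apply: uniq_perm.
- rewrite map_inj_in_uniq.
    rewrite filter_uniq // allpairs_uniq_dep ?packed_words_uniq //.
      by move=> w _; apply: iota_uniq.
    by move=> [w k] [w' k'] _ _ /= [-> ->].
  move=> [w k] [w' k']; rewrite !memS.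
  move=> /and4P[_ /eqP e1 /eqP s1 k1] /and4P[_ /eqP e2 /eqP s2 k2] e.
  have [] := cut_inj s1 s2 k1 k2 _ (congr1 fst e) (congr1 snd e).
    by rewrite e1.
  by move=> -> ->.
- rewrite allpairs_uniq ?filter_uniq ?packed_words_uniq //.
  by move=> [a b] [a' b'] _ _ /= [-> ->].
move=> [u v]; apply/mapP/allpairsP => [[[w k]]|[[u' v'] /= []]].
  rewrite memS => /and4P[lw /eqP eO /eqP sw kw] /= [-> ->].
  have lb := linearises_restr (~: O) lw; have la := linearises_restr O lw.
  exists (below w k, above w k); split=> //.
    rewrite /= mem_filter mem_packed_words below_cut // eO lb.
    by rewrite size_subword eqxx.
  rewrite /= mem_filter mem_packed_words above_cut // eO.
  rewrite (linearises_same_order _ _ (same_order_pack _)) la.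
  by rewrite size_pack size_subword eqxx.
rewrite !mem_filter !mem_packed_words => /andP[lu /eqP su] /andP[lv /eqP sv] [-> ->].
exists (glue_word su sv, maxw u'); last by rewrite /= below_glue above_glue.
by rewrite memS cut_glue size_glue maxw_glue !eqxx linearises_glue.
Qed.

End CutGlue.

(** Compatibility with the coproducts, for an arbitrary function of the two
    halves in place of the tensor product. *)
Lemma sum_cut_restr (V : nmodType) c n (P : qposet n) (F : pword -> pword -> V) :
  \sum_(w <- packed_words n | linearises c P w)
    \sum_(0 <= k < (maxw w).+1) F (below w k) (above w k) =
  \sum_(O in topens P)
    \sum_(u <- packed_words #|~: O| | linearises c (tagged (std_restr P (~: O))) u)
      \sum_(v <- packed_words #|O| | linearises c (tagged (std_restr P O)) v) F u v.
Proof.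
pose S : seq (pword * nat) :=
  [seq (w, k) | w <- packed_words n, k <- index_iota 0 (maxw w).+1].
transitivity (\sum_(p <- S | linearises c P p.1) F (below p.1 p.2) (above p.1 p.2)).
  rewrite big_mkcond [RHS]big_mkcond big_allpairs_dep /=; apply: eq_bigr => w _.
  by case: ifP => _ //; rewrite big1.
rewrite (partition_big (fun p : pword * nat => cut n p.1 p.2)
          (mem (topens P))) /=; last by move=> p; apply: cut_topens.
apply: eq_bigr => O openO.
rewrite -big_filter.
rewrite -(big_map (fun p => (below p.1 p.2, above p.1 p.2)) predT
            (fun q => F q.1 q.2)).
rewrite (perm_big _ (perm_cut_restr c openO)) big_allpairs_dep big_filter.
by apply: eq_bigr => u _; rewrite big_filter.
Qed.

(** * Linear maps on free modules *)

Section LinearMaps.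
Variable K : fieldType.
Implicit Types B C D : choiceType.

HB.instance Definition _ B (V : lmodType K) (f : B -> V) :=
  GRing.isLinear.Build K {malg K[B]} V *:%R (lin_ext f) (lin_ext_is_linear f).

Lemma eq_lin_ext B (V : lmodType K) (f g : B -> V) :
  f =1 g -> lin_ext f =1 lin_ext g.
Proof. by move=> fg x; apply: eq_bigr => b _; rewrite fg. Qed.

Lemma linear_lin_ext B (V W : lmodType K) (g : V -> W) (f : B -> V) x :
  linear g -> g (lin_ext f x) = lin_ext (fun b => g (f b)) x.
Proof.
move=> lg; pose gl := GRing.isLinear.Build _ _ _ _ g lg.
pose G : {linear V -> W} := HB.pack g gl.
rewrite -[g]/(G : V -> W) /lin_ext linear_sum; apply: eq_bigr => b _.
by rewrite linearZ.
Qed.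

(** Stated over a field, so that the scaling of [lin_ext] is recognised. *)
Lemma mcoeff_scale B (a : K) (x : {malg K[B]}) b : (a *: x)@_b = a * x@_b.
Proof. exact: mcoeffZ. Qed.

Lemma lin_ext_id B (x : {malg K[B]}) : lin_ext (fun b => << b >>) x = x.
Proof.
rewrite [RHS]monalgE; apply: eq_bigr => b _.
by apply/malgP => c; rewrite mcoeff_scale !mcoeffU mulr_natr.
Qed.

Lemma linear_basis B (V : lmodType K) (g : {malg K[B]} -> V) x :
  linear g -> g x = lin_ext (fun b => g << b >>) x.
Proof. by move=> lg; rewrite -{1}(lin_ext_id x) linear_lin_ext. Qed.

Lemma mcoeff_lin_ext B C (f : B -> {malg K[C]}) x c :
  (lin_ext f x)@_c = \sum_(b <- msupp x) x@_b * (f b)@_c.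
Proof.
by rewrite /lin_ext raddf_sum; apply: eq_bigr => b _ /=; rewrite mcoeff_scale.
Qed.

Lemma bilin_extC B C (V : lmodType K) (h : B -> C -> V) x y :
  bilin_ext h x y = bilin_ext (fun c b => h b c) y x.
Proof.
rewrite /bilin_ext /lin_ext.
under eq_bigr do rewrite scaler_sumr; rewrite exchange_big /=.
under [RHS]eq_bigr do rewrite scaler_sumr; apply: eq_bigr => c _.
by apply: eq_bigr => b _; rewrite !scalerA mulrC.
Qed.

Lemma bilin_ext_linearl B C (V : lmodType K) (h : B -> C -> V) y :
  linear (fun x => bilin_ext h x y).
Proof. exact: lin_ext_is_linear. Qed.

Lemma bilin_ext_linearr B C (V : lmodType K) (h : B -> C -> V) x :
  linear (bilin_ext h x).
Proof.
by move=> a y z; rewrite bilin_extC bilin_ext_linearl ![bilin_ext _ _ x]bilin_extC.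
Qed.

Lemma bilin_ext_sum B C (V : lmodType K) (h : B -> C -> V)
    (r : seq B) (p : pred B) (s : seq C) (q : pred C) :
  bilin_ext h (\sum_(b <- r | p b) << b >>) (\sum_(c <- s | q c) << c >>) =
  \sum_(b <- r | p b) \sum_(c <- s | q c) h b c.
Proof.
rewrite /bilin_ext linear_sum; apply: eq_bigr => b _.
by rewrite /= lin_extU linear_sum; apply: eq_bigr => c _; rewrite /= lin_extU.
Qed.

Lemma bilin_ext_morph B C (h : B -> B -> {malg K[B]}) (h' : C -> C -> {malg K[C]})
    (F : B -> {malg K[C]}) :
  (forall a b, lin_ext F (h a b) = bilin_ext h' (F a) (F b)) ->
  forall x y,
    lin_ext F (bilin_ext h x y) = bilin_ext h' (lin_ext F x) (lin_ext F y).
Proof.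
move=> Fh x y; rewrite [LHS](linear_lin_ext _ _ (lin_ext_is_linear F)).
rewrite [RHS](linear_lin_ext _ _ (@bilin_ext_linearl _ _ _ h' (lin_ext F y))).
apply: eq_lin_ext => a; rewrite [LHS](linear_lin_ext _ _ (lin_ext_is_linear F)).
rewrite [RHS](linear_lin_ext _ _ (@bilin_ext_linearr _ _ _ h' (F a))).
by apply: eq_lin_ext => b; rewrite Fh.
Qed.

(** This is how m o (T (x) id), in the shape in which it occurs in the definition
    of an antipode, is evaluated on f(P1) (x) f(P2), whose factors are not basis
    elements. *)
Lemma lin_ext_tensor B C D (V : lmodType K) (h : D -> C -> V)
    (g : {malg K[B]} -> {malg K[D]}) x y : linear g ->
  lin_ext (fun p : B * C => bilin_ext h (g << p.1 >>) << p.2 >>) (tensor x y) =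
  bilin_ext h (g x) y.
Proof.
move=> lg; set G := fun p => _.
have lin1 : linear (fun z => bilin_ext h (g z) y).
  by move=> a u v; rewrite lg bilin_ext_linearl.
rewrite [RHS](linear_basis x lin1) [LHS](linear_lin_ext _ _ (lin_ext_is_linear G)).
apply: eq_lin_ext => b; rewrite [LHS](linear_lin_ext _ _ (lin_ext_is_linear G)).
rewrite [RHS](linear_basis y (@bilin_ext_linearr _ _ _ h (g << b >>))).
by apply: eq_lin_ext => c; rewrite lin_extU.
Qed.

End LinearMaps.

(** * Quasi-posets up to a change of type *)

(** Elements of [QP] carry their number of vertices in their type; this allows
    two of them to be compared when these numbers are only provably equal. *)
Lemma eq_QP (P Q : QP) (e : tag P = tag Q) :
  (forall i j, qle (tagged P) i j = qle (tagged Q) (cast_ord e i) (cast_ord e j)) ->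
  P = Q.
Proof.
case: P Q e => n P [m Q] /= e; subst m => h.
congr existT; apply: val_inj; apply/setP => -[i j].
by have := h i j; rewrite !cast_ord_id.
Qed.

Lemma std_restr_full n (P : qposet n) (A : {set 'I_n}) :
  A = setT -> std_restr P A = Tagged qposet P.
Proof.
move=> AT; have e : #|A| = n by rewrite AT cardsT card_ord.
apply: (@eq_QP (std_restr P A) (Tagged qposet P) e) => i j; rewrite qle_std_restr /=.
have ev (k : 'I_#|A|) : enum_val k = cast_ord e k.
  apply: val_inj; rewrite (enum_val_nth (enum_val k)).
  have -> : enum A = enum 'I_n by apply: eq_enum => i'; rewrite AT inE.
  by rewrite /= nth_enum_ord // -[X in (_ < X)%N]e.
by rewrite !ev.
Qed.

Lemma std_restr_set0 n (P : qposet n) : std_restr P set0 = empty_QP.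
Proof.
have e : #|set0 : {set 'I_n}| = 0%N by rewrite cards0.
by apply: (@eq_QP (std_restr P set0) empty_QP e) => i; move: (cast_ord e i) => [].
Qed.

Lemma qposet0_eq (P : qposet 0) : Tagged qposet P = empty_QP.
Proof. by apply: (@eq_QP (Tagged qposet P) empty_QP erefl) => -[]. Qed.

(** A filtered sum with at most one nonzero term; it collapses the sums over the
    packings of the two parts of a word. *)
Lemma sum_packed_at (V : nmodType) n (p : pred pword) (u : pword) (F : pword -> V) :
  size u = n -> (forall w, w != u -> F w = 0) ->
  \sum_(w <- packed_words n | p w) F w = if p u then F u else 0.
Proof.
move=> su F0; rewrite big_mkcond (bigD1_seq u) ?packed_words_uniq //=; last first.
  by rewrite mem_packed_words su.
by rewrite big1 ?addr0 // => w /F0 ->; case: ifP.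
Qed.

Lemma sum_packed1 (V : nmodType) n (p : pred pword) (u : pword) (F : pword -> V) :
  size u = n -> (forall w : pword, size w = n -> p w = (w == u)) ->
  \sum_(w <- packed_words n | p w) F w = F u.
Proof.
move=> su pu; rewrite big_mkcond /=.
rewrite (eq_big_seq (fun w : pword => if w == u then F w else 0)) => [|w];
  last first.
  by rewrite mem_packed_words => /eqP /pu ->.
by rewrite (sum_packed_at predT su) ?eqxx // => w /negbTE ->.
Qed.

(** * Compatibility with the Hopf operations *)

Section EhrhartMorphism.

(** [L] stands for [in_W] or [in_Wstr], so that [ehr] is convertible to [EHR] or
    [EHRstr]. *)
Variables (K : fieldType) (c : bool) (L : forall n, qposet n -> pword -> bool).
Hypothesis LE : forall n (P : qposet n) w, L P w = linearises c P w.

Definition word_sum (P : QP) : {malg K[pword]} :=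
  \sum_(w <- packed_words (tag P) | L (tagged P) w) << w >>.

Definition ehr : {malg K[QP]} -> {malg K[pword]} := lin_ext word_sum.

Lemma ehr_linear : linear ehr. Proof. exact: lin_ext_is_linear. Qed.

Lemma word_sumE (P : QP) :
  word_sum P = \sum_(w <- packed_words (tag P) | linearises c (tagged P) w) << w >>.
Proof. by apply: eq_bigl => w; rewrite LE. Qed.

Lemma word_sum_empty : word_sum empty_QP = << pack [::] >>.
Proof.
rewrite word_sumE (sum_packed1 (u := pack [::])) // => w /size0nil w0.
apply/idP/eqP => [_ | _]; first by apply: val_inj; rewrite /= w0.
by apply/linearisesP; rewrite w0; split=> // -[].
Qed.

(** Each word [w] that respects the disjoint union appears once on the right, in
    the product of the packings of its two parts. *)
Lemma ehr_mul x y : ehr (hmul (HQP K) x y) = hmul (WQSym K) (ehr x) (ehr y).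
Proof.
apply: bilin_ext_morph => -[k P] [l Q].
rewrite lin_extU !word_sumE /= bilin_ext_sum.
pose lP (u : pword) := linearises c P u; pose lQ (v : pword) := linearises c Q v.
transitivity (\sum_(u <- packed_words k | lP u) \sum_(v <- packed_words l | lQ v)
   \sum_(w <- packed_words (k + l)%N)
     if (pack (take k w) == u) && (pack (drop k w) == v)
     then << w >> else 0 : {malg K[pword]}).
  rewrite (eq_bigr _ (fun u _ => exchange_big _ _ _ _ _ _)) exchange_big /=.
  rewrite big_mkcond; apply: eq_big_seq => w.
  rewrite mem_packed_words => /eqP sw.
  rewrite linearises_dunion //.
  rewrite -(linearises_same_order _ _ (same_order_pack (take k w))).
  rewrite -(linearises_same_order _ _ (same_order_pack (drop k w))).
  have st : size (pack (take k w)) = k.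
    by rewrite size_pack size_takel // sw leq_addr.
  have sd : size (pack (drop k w)) = l by rewrite size_pack size_drop sw addKn.
  rewrite (sum_packed_at _ st) => [|u]; last first.
    by rewrite eq_sym => /negbTE ->; rewrite big1.
  rewrite (sum_packed_at _ sd) => [|v]; last first.
    by rewrite eq_sym => /negbTE ->; rewrite andbF.
  by rewrite !eqxx /lP /lQ; case: linearises => //; case: linearises.
rewrite big_seq_cond [RHS]big_seq_cond; apply: eq_bigr => u.
rewrite mem_packed_words => /andP[/eqP su _].
rewrite big_seq_cond [RHS]big_seq_cond; apply: eq_bigr => v.
rewrite mem_packed_words => /andP[/eqP sv _].
by rewrite su sv [RHS]big_mkcond.
Qed.

Lemma ehr_comul x : hcomul (WQSym K) (ehr x) = tensor_map ehr ehr (hcomul (HQP K) x).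
Proof.
rewrite [LHS](linear_lin_ext _ _ (lin_ext_is_linear _)).
rewrite [RHS](linear_lin_ext _ _ (lin_ext_is_linear _)).
apply: eq_lin_ext => -[n P]; rewrite word_sumE !linear_sum /=.
under eq_bigr do rewrite lin_extU.
rewrite (sum_cut_restr c P (fun u v => << (u, v) >>)); apply: eq_bigr => O _.
rewrite lin_extU /=.
transitivity (tensor (word_sum (std_restr P (~: O))) (word_sum (std_restr P O))).
  rewrite (word_sumE (std_restr P (~: O))) (word_sumE (std_restr P O)).
  by rewrite /tensor bilin_ext_sum.
by congr tensor; apply/esym/lin_extU.
Qed.

Lemma ehr_counit x : hcounit (WQSym K) (ehr x) = hcounit (HQP K) x.
Proof.
rewrite /= mcoeff_lin_ext -[in RHS](lin_ext_id x) mcoeff_lin_ext.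
apply: eq_bigr => P _; congr (_ * _); rewrite mcoeffU.
case: (eqVneq P empty_QP) => [->|P0]; first by rewrite word_sum_empty mcoeffU eqxx.
rewrite /word_sum raddf_sum big1_seq // => w /andP[_].
rewrite mem_packed_words /= mcoeffU => /eqP sw; case: eqP => // w0.
move: sw P0; rewrite w0 /=; case: P => n P /= n0; move: P; rewrite -{}n0 => P.
by move=> /negP[]; apply/eqP; apply: qposet0_eq.
Qed.

Lemma ehr_one : ehr (hone (HQP K)) = hone (WQSym K).
Proof. exact: etrans (lin_extU _ _) word_sum_empty. Qed.

Lemma wqsym_mul1 x : hmul (WQSym K) x << pack [::] >> = x.
Proof.
rewrite -[RHS]lin_ext_id; apply: eq_lin_ext => u; rewrite lin_extU.
apply: sum_packed1 => [|w]; rewrite addn0 // => sw.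
rewrite take_oversize ?sw // drop_oversize ?sw // pack_id.
by rewrite eqxx andbT.
Qed.

Lemma lin_ext_comul (V : lmodType K) (G : QP * QP -> V) (P : QP) :
  lin_ext G (hcomul (HQP K) << P >>) =
  \sum_(O in topens (tagged P))
    G (std_restr (tagged P) (~: O), std_restr (tagged P) O).
Proof.
rewrite [hcomul _ _]lin_extU linear_sum; apply: eq_bigr => O _.
exact: lin_extU.
Qed.

(** * Compatibility with the antipodes *)

Section Antipodes.
Variables (S : {malg K[QP]} -> {malg K[QP]})
          (T : {malg K[pword]} -> {malg K[pword]}).
Hypotheses (aS : is_antipode (HQP K) S) (aT : is_antipode (WQSym K) T).

(** The convolution product of [g] and [ehr] at the basis element [P]. *)
Let conv (g : {malg K[QP]} -> {malg K[pword]}) (P : QP) : {malg K[pword]} :=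
  \sum_(O in topens (tagged P))
    hmul (WQSym K) (g << std_restr (tagged P) (~: O) >>)
                   (word_sum (std_restr (tagged P) O)).

(** The empty open set leaves [P] whole on the left and the unit on the right;
    any other open set leaves fewer vertices on the left. *)
Lemma conv_rec g P : conv g P = g << P >> +
  \sum_(O in topens (tagged P) | O != set0)
    hmul (WQSym K) (g << std_restr (tagged P) (~: O) >>)
                   (word_sum (std_restr (tagged P) O)).
Proof.
have O0 : set0 \in topens (tagged P) by apply/topensP => i j; rewrite inE.
rewrite /conv (bigD1 set0 O0); congr (_ + _).
rewrite std_restr_set0 word_sum_empty; apply: etrans (wqsym_mul1 _) _.
by rewrite std_restr_full ?setC0 //; case: (P).
Qed.

(** [ehr] is multiplicative, and [S] is a left inverse of the identity. *)
Lemma conv_ehrS P :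
  conv (fun x => ehr (S x)) P = hcounit (HQP K) << P >> *: hone (WQSym K).
Proof.
have [_ SL _] := aS.
transitivity (ehr (hcounit (HQP K) << P >> *: hone (HQP K))); last first.
  by rewrite -ehr_one; apply: linearZ.
rewrite -SL lin_ext_comul [RHS]linear_sum; apply: eq_bigr => O _.
rewrite [RHS]ehr_mul; congr (hmul (WQSym K) _ _).
by symmetry; apply: lin_extU.
Qed.

(** [ehr] is comultiplicative, and [T] is a left inverse of the identity. *)
Lemma conv_Tehr P :
  conv (fun x => T (ehr x)) P = hcounit (HQP K) << P >> *: hone (WQSym K).
Proof.
have [lT TL _] := aT.
rewrite -ehr_counit -TL ehr_comul /tensor_map lin_ext_comul [RHS]linear_sum.
apply: eq_bigr => O _; rewrite [RHS](lin_ext_tensor _ _ _ lT).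
by congr (hmul (WQSym K) _ _); symmetry; apply: lin_extU.
Qed.

(** Two left inverses of [ehr] for convolution agree, by induction on the number
    of vertices. *)
Lemma ehr_antipode x : ehr (S x) = T (ehr x).
Proof.
have [lS _ _] := aS; have [lT _ _] := aT.
rewrite (linear_basis x lS) [LHS](linear_lin_ext _ _ ehr_linear).
rewrite [RHS](linear_lin_ext _ _ lT); apply: eq_lin_ext => P.
suff : ehr (S << P >>) = T (ehr << P >>) by rewrite [ehr << P >>]lin_extU.
move eqn: (tag P) => n; elim/ltn_ind: n P eqn => n IHn P Pn.
have := conv_ehrS P; rewrite -(conv_Tehr P) !conv_rec.
rewrite (eq_bigr (fun O => hmul (WQSym K) (T (ehr << std_restr (tagged P) (~: O) >>))
                   (word_sum (std_restr (tagged P) O)))); first exact: addIr.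
move=> O /andP[_ O1]; congr (hmul (WQSym K) _ _); apply: (IHn #|~: O|) => //.
rewrite -Pn -[X in (_ < X)%N]card_ord -[X in (_ < X)%N](cardsC O).
by rewrite -[X in (X < _)%N]add0n ltn_add2r card_gt0.
Qed.

End Antipodes.

Lemma ehr_hopf_morphism : hopf_morphism (HQP K) (WQSym K) ehr.
Proof.
split.
- exact: ehr_linear.
- exact: ehr_mul.
- exact: ehr_one.
- exact: ehr_comul.
- exact: ehr_counit.
- by move=> S T aS aT x; apply: ehr_antipode.
Qed.

(** * Surjectivity *)

Section Surjectivity.

Variable n : nat.

Definition pattern_rel (s : seq nat) (i j : 'I_n) : bool :=
  (nth 0%N s i <= nth 0%N s j)%N.

Fact pattern_refl s : reflexive (pattern_rel s).
Proof. by move=> i; apply: leqnn. Qed.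

Fact pattern_trans s : transitive (pattern_rel s).
Proof. by move=> j i k; apply: leq_trans. Qed.

Definition pattern (s : seq nat) : qposet n :=
  qposet_of (pattern_refl s) (@pattern_trans s).

Lemma qle_pattern s i j : qle (pattern s) i j = (nth 0%N s i <= nth 0%N s j)%N.
Proof. exact: qle_of. Qed.

Lemma linearises_pattern (w : pword) : size w = n -> linearises c (pattern w) w.
Proof.
by move=> sw; apply/linearisesP; split=> // i j; rewrite !qle_pattern.
Qed.

(** Respecting the pattern of [w] means having all its relations; a packed word
    with no further relation has the same order of letters, hence equals [w]. *)
Lemma linearises_pattern_lt (w w' : pword) :
  size w = n -> linearises c (pattern w) w' -> w' != w ->
  (#|qgraph (pattern w)| < #|qgraph (pattern w')|)%N.
Proof.
move=> sw /linearisesP[sw' h]; apply: contraNltn => le.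
have sub : qgraph (pattern w) \subset qgraph (pattern w').
  by apply/subsetP => -[i j] /(h i j)[w'ij _]; rewrite -/(qle _ i j) qle_pattern.
have /eqP e : qgraph (pattern w) == qgraph (pattern w') by rewrite eqEcard sub.
apply/eqP/esym/packed_same_order; split=> [|i j]; rewrite sw // => hi hj.
have /setP/(_ (Ordinal hi, Ordinal hj)) := e.
by rewrite -!/(qle _ _ _) !qle_pattern.
Qed.

End Surjectivity.

Let im y := exists x, ehr x = y.

Lemma im_sum I (r : seq I) (p : pred I) (F : I -> {malg K[pword]}) :
  (forall i, p i -> im (F i)) -> im (\sum_(i <- r | p i) F i).
Proof.
move=> imF; elim/big_ind: _ => //; first by exists 0; apply: linear0.
by move=> _ _ [x <-] [y <-]; exists (x + y); apply: linearD.
Qed.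

(** Unitriangularity: the image of the pattern of [w] is [w] plus words with more
    relations, whose preimages are subtracted. *)
Lemma im_word w : im << w >>.
Proof.
move eqn: (size w) => n.
move: {2}(n * n - #|_|)%N (leqnn (n * n - #|qgraph (pattern n w)|)%N) => m.
elim/ltn_ind: m w eqn => m IHm w sw le_m.
pose R := \sum_(w' <- packed_words n | linearises c (pattern n w) w' && (w' != w))
  (<< w' >> : {malg K[pword]}).
have [x ex] : im R.
  apply: im_sum => w' /andP[lw' ww']; have [sw' _] := linearisesP _ _ _ lw'.
  have lt := linearises_pattern_lt sw lw' ww'.
  have card_le : (#|qgraph (pattern n w')| <= n * n)%N.
    by have := max_card (mem (qgraph (pattern n w'))); rewrite card_prod card_ord.
  apply: (IHm (n * n - #|qgraph (pattern n w')|)%N) => //.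
  by apply: leq_trans le_m; rewrite ltn_sub2l // (leq_trans lt).
exists (<< Tagged qposet (pattern n w) : QP >> - x).
have -> : << w >> = word_sum (Tagged qposet (pattern n w)) - R.
  have memw : w \in packed_words n by rewrite mem_packed_words sw.
  have -> : R = \sum_(w' <- packed_words n | w' != w)
      if linearises c (pattern n w) w' then << w' >> else 0.
    exact: (big_mkcondl _ _ (fun w' : pword => linearises c (pattern n w) w')).
  rewrite word_sumE big_mkcond (bigD1_seq w memw (packed_words_uniq n)) /=.
  by rewrite [X in if X then _ else _]linearises_pattern // addrK.
by rewrite -ex -[word_sum _](lin_extU word_sum); apply: linearB.
Qed.

Lemma ehr_surj y : exists x, ehr x = y.
Proof.
rewrite -[y]lin_ext_id; apply: im_sum => w _; have [x <-] := im_word w.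
by exists (y@_w *: x); apply: linearZ.
Qed.

End EhrhartMorphism.

Theorem proposition41 (K : fieldType) (charK : [pchar K] =i pred0) :
  (hopf_morphism (HQP K) (WQSym K) (@EHR K) /\
   (forall y : {malg K[pword]}, exists x : {malg K[QP]}, EHR x = y)) /\
  (hopf_morphism (HQP K) (WQSym K) (@EHRstr K) /\
   (forall y : {malg K[pword]}, exists x : {malg K[QP]}, EHRstr x = y)).
Proof.
split; split.
- exact: (ehr_hopf_morphism K in_WE).
- exact: (ehr_surj in_WE).
- exact: (ehr_hopf_morphism K in_WstrE).
- exact: (ehr_surj in_WstrE).
Qed.
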